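(* Let $\mathbb{K}$ be a field of characteristic zero, $A$ a finite-dimensional pre-Malcev algebra over $\mathbb{K}$, $V$ a finite-dimensional $A$-bimodule, and $T:V\to A$ a Kupershmidt operator on $A_V$. Then $V$ endowed with the multiplication $$u\diamond^{T}v:=\ell_{T(u)}(v)+r_{T(v)}(u)\qquad (u,v\in V)$$ is a pre-Malcev algebra.
   Context: A pre-Malcev algebra over $\mathbb{K}$ is a nonassociative algebra $A$ over $\mathbb{K}$ such that for all $x,y,z,t\in A$: $(yz-zy)(xt)+((xy-yx)z-z(xy-yx))t+y((xz-zx)t)-x(y(zt))+z(x(yt))=0$. An $A$-bimodule is a vector space $V$ with linear maps $\ell,r:A\to\mathfrak{gl}(V)$, $x\mapsto\ell_x$, $x\mapsto r_x$, such that for all $x,y,z\in A$: (i) $r_x r_y r_z-r_x r_y\ell_z-r_x\ell_y r_z+r_x\ell_y\ell_z-r_{z(yx)}+\ell_y r_{zx}+\ell_{zy}r_x-\ell_{yz}r_x-\ell_z r_x\ell_y+\ell_z r_x r_y=0$; (ii) $r_{x}r_{y}\ell_{z}-r_{x}r_{y}r_{z}-r_{x}\ell_{y}\ell_{z}+r_{x}\ell_{y}r_{z}-\ell_{z}r_{yx}+\ell_{y}\ell_{z}r_{x}+r_{zx}r_{y}-r_{zx}\ell_{y}-r_{(yz)x}+r_{(zy)x}=0$; (iii) $r_{x}\ell_{yz}-r_{x}\ell_{zy}-r_{x}r_{yz}+r_{x}r_{zy}-\ell_{y}\ell_{z}r_{x}+r_{y(zx)}+r_{yx}\ell_{z}-r_{yx}r_{z}-\ell_{z}r_{x}r_{y}+\ell_{z}r_{x}\ell_{y}=0$;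 (iv) $\ell_{(xy)z}-\ell_{(yx)z}-\ell_{z(xy)}+\ell_{z(yx)}-\ell_{x}\ell_{y}\ell_{z}+\ell_{z}\ell_{x}\ell_{y}+\ell_{yz}\ell_{x}-\ell_{zy}\ell_{x}-\ell_{y}\ell_{zx}+\ell_{y}\ell_{xz}=0$. $A_V$ denotes the action of $A$ on $V$ given by $\ell,r$. A Kupershmidt operator on $A_V$ is a linear map $T:V\to A$ with $T(u)T(v)=T(\ell_{T(u)}(v)+r_{T(v)}(u))$ for all $u,v\in V$. *)

(* Defs.v *)
From HB Require Import structures.
From mathcomp Require Import all_boot all_order all_algebra.

Set Implicit Arguments.
Unset Strict Implicit.
Unset Printing Implicit Defensive.

Import GRing.Theory.
Local Open Scope ring_scope.

Reserved Notation "x ∙ y" (at level 40, left associativity).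
Reserved Notation "f ∘ g" (at level 40, left associativity).

(* Composition is displayed as ∘ at the level of multiplication, because the
   library's \o is at the same level as + . *)
Local Notation "f ∘ g" := (comp_lfun f g) : ring_scope.

Section PreMalcev.

Variables (K : fieldType) (A : vectType K) (mul : A -> A -> A).
Local Notation "x ∙ y" := (mul x y) : ring_scope.

Record is_nonassoc_algebra : Prop := IsNonassocAlgebra {
  mul_linearl : forall y, linear (mul^~ y);
  mul_linearr : forall x, linear (mul x)
}.

Record is_pre_malcev : Prop := IsPreMalcev {
  pre_malcev_algebra : is_nonassoc_algebra;
  pre_malcev_identity : forall x y z t,
    (y ∙ z - z ∙ y) ∙ (x ∙ t)
    + ((x ∙ y - y ∙ x) ∙ z - z ∙ (x ∙ y - y ∙ x)) ∙ t
    + y ∙ ((x ∙ z - z ∙ x) ∙ t)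
    - x ∙ (y ∙ (z ∙ t)) + z ∙ (x ∙ (y ∙ t)) = 0
}.

Variables (V : vectType K) (l r : {linear A -> 'End(V)}).

Record is_bimodule : Prop := IsBimodule {
  bimodule_i : forall x y z,
    r x ∘ r y ∘ r z - r x ∘ r y ∘ l z - r x ∘ l y ∘ r z + r x ∘ l y ∘ l z
    - r (z ∙ (y ∙ x)) + l y ∘ r (z ∙ x) + l (z ∙ y) ∘ r x - l (y ∙ z) ∘ r x
    - l z ∘ r x ∘ l y + l z ∘ r x ∘ r y = 0;
  bimodule_ii : forall x y z,
    r x ∘ r y ∘ l z - r x ∘ r y ∘ r z - r x ∘ l y ∘ l z + r x ∘ l y ∘ r z
    - l z ∘ r (y ∙ x) + l y ∘ l z ∘ r x + r (z ∙ x) ∘ r y - r (z ∙ x) ∘ l y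
    - r ((y ∙ z) ∙ x) + r ((z ∙ y) ∙ x) = 0;
  bimodule_iii : forall x y z,
    r x ∘ l (y ∙ z) - r x ∘ l (z ∙ y) - r x ∘ r (y ∙ z) + r x ∘ r (z ∙ y)
    - l y ∘ l z ∘ r x + r (y ∙ (z ∙ x)) + r (y ∙ x) ∘ l z - r (y ∙ x) ∘ r z
    - l z ∘ r x ∘ r y + l z ∘ r x ∘ l y = 0;
  bimodule_iv : forall x y z,
    l ((x ∙ y) ∙ z) - l ((y ∙ x) ∙ z) - l (z ∙ (x ∙ y)) + l (z ∙ (y ∙ x))
    - l x ∘ l y ∘ l z + l z ∘ l x ∘ l y + l (y ∙ z) ∘ l x - l (z ∙ y) ∘ l x
    - l y ∘ l (z ∙ x) + l y ∘ l (x ∙ z) = 0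
}.

Variable T : {linear V -> A}.

Definition diamond (u v : V) : V := l (T u) v + r (T v) u.

Definition is_kupershmidt_operator : Prop :=
  forall u v, T u ∙ T v = T (l (T u) v + r (T v) u).

End PreMalcev.

(* Main.v *)
Require Import Defs.
From HB Require Import structures.
From mathcomp Require Import all_boot all_order all_algebra.
From mathcomp Require Import ring.

(** Since T maps the product of V to that of A, the pre-Malcev expression of
    x, y, z, t in V expands into terms in which exactly one of the four
    arguments stays in V while the others act through T. The terms where x, y,
    z or t stays in V add up to the bimodule axioms (i), (ii), (iii) and (iv)
    respectively, applied to that argument. *)

Set Implicit Arguments.
Unset Strict Implicit.
Unset Printing Implicit Defensive.

Import GRing.Theory.
Local Open Scope ring_scope.

Lemma diamond_nonassoc_algebra (K : fieldType) (A V : vectType K)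
    (l r : {linear A -> 'End(V)}) (T : {linear V -> A}) :
  is_nonassoc_algebra (diamond l r T).
Proof.
split=> [y|x] a u v; rewrite /diamond !linearP add_lfunE scale_lfunE;
  by rewrite !scalerDr addrACA.
Qed.

(** Coordinates reduce an equation in [V] to equations in the field [K], where [ring] applies. *)
Lemma eq_coord_vbasis (K : fieldType) (V : vectType K) (u v : V) :
  (forall i, coord (vbasis fullv) i u = coord (vbasis fullv) i v) -> u = v.
Proof.
move=> eq_uv; have [-> ->] := (coord_vbasis (memvf u), coord_vbasis (memvf v)).
by apply: eq_bigr => i _; rewrite eq_uv.
Qed.

Theorem proposition3p4 (K : fieldType) (charK0 : [pchar K] =i pred0)
    (A : vectType K) (mul : A -> A -> A) (preA : is_pre_malcev mul)
    (V : vectType K) (l r : {linear A -> 'End(V)}) (bimV : is_bimodule mul l r)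
    (T : {linear V -> A}) (kupT : is_kupershmidt_operator mul l r T) :
  is_pre_malcev (diamond l r T).
Proof.
split=> [|x y z t]; first exact: diamond_nonassoc_algebra.
have [[mulDl mulDr] _] := preA.
(* [linear] speaks of [a *: u + v], so [u - v] is read as [-1 *: v + u]. *)
have mulBl b : {morph mul^~ b : u v / u - v}.
  by move=> u v; rewrite addrC -scaleN1r mulDl scaleN1r addrC.
have mulBr b : {morph mul b : u v / u - v}.
  by move=> u v; rewrite addrC -scaleN1r mulDr scaleN1r addrC.
have [ax1 ax2 ax3 ax4] := bimV.
(* The arguments are matched on nested products, writing a for [T a] in subscripts: - x(y(zt)) gives
   - r_{y(zt)} on [x], - l_x l_y r_t on [z] and - l_x l_y l_z on [t]; z(x(yt)) gives l_z l_x r_t on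
   [y]. *)
move: (congr1 (fun f : 'End(V) => f x) (ax1 (T t) (T z) (T y)))
      (congr1 (fun f : 'End(V) => f y) (ax2 (T t) (T z) (T x)))
      (congr1 (fun f : 'End(V) => f z) (ax3 (T t) (T x) (T y)))
      (congr1 (fun f : 'End(V) => f t) (ax4 (T x) (T y) (T z))).
rewrite !(add_lfunE, opp_lfunE, comp_lfunE, zero_lfunE) => e1 e2 e3 e4.
have := congr2 +%R (congr2 +%R e1 e2) (congr2 +%R e3 e4).
(* The right-hand 0 becomes the sum of the four instances. *)
rewrite !addr0 => {e1 e2 e3 e4}<-.
set d := diamond l r T.
have dE u v : d u v = l (T u) v + r (T v) u by [].
have TM u v : T (d u v) = mul (T u) (T v) by rewrite kupT.
have TB : {morph T : u v / u - v} by exact: linearB.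
have lB := linearB l; have rB := linearB r.
have fD (f : 'End(V)) := linearD f; have fN (f : 'End(V)) := linearN f.
(* Products are unfolded from the outside in: TM no longer applies to a product
   that has been unfolded under T. *)
rewrite (dE (_ - _) (d _ _)) (dE (_ - d _ (_ - _))) (dE _ (d (_ - _) _)).
rewrite !(dE _ (d _ (d _ _))) !(TM, TB).
rewrite !(dE (_ - _)) !(dE _ (_ - _)) !(dE _ (d _ _)) !(TM, TB) !dE.
rewrite !(mulBl, mulBr, lB, rB).
rewrite !(add_lfunE, opp_lfunE, fN, fD).
(* In coordinates the remaining identity is one between scalars. *)
apply: eq_coord_vbasis => i; set c := coord _ i.
have cD : {morph c : u v / u + v} by exact: linearD.
have cN : {morph c : u / - u} by exact: linearN.
rewrite !(cD, cN).
ring.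
Qed.
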